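(* The fraction of functions $f:\mathbb{Z}_2^n\to\mathbb{Z}_2$ (among all $2^{2^n}$ such functions) that are $q$-locally correctable for $\varepsilon=2^{-n}$ (i.e. from a single error) by an algorithm using $q<n/100$ non-adaptive queries tends to $0$ as $n\to\infty$.
   Context: For $f:\mathbb{Z}_2^n\to\mathbb{Z}_2$ and a permutation $\sigma\in\mathcal{S}_n$, let $f_\sigma(x_1,\dots,x_n)=f(x_{\sigma(1)},\dots,x_{\sigma(n)})$; such an $f_\sigma$ is called an isomorphism of $f$. Two functions $f,g:\mathbb{Z}_2^n\to\mathbb{Z}_2$ are $\varepsilon$-close if $\Pr_x[f(x)\ne g(x)]\le\varepsilon$ for uniformly random $x\in\mathbb{Z}_2^n$. Local correction: $f$ (known to the algorithm) is $q$-locally correctable for $\varepsilon>0$ if there is a randomized algorithm which, for every $\sigma\in\mathcal{S}_n$, every $g$ that is $\varepsilon$-close to $f_\sigma$, and every $x\in\mathbb{Z}_2^n$, given $x$ and black-box (query) access to $g$ (but not $\sigma$), outputs $f_\sigma(x)$ with probability at least $2/3$ using at most $q$ queries to $g$. The algorithm is non-adaptive if its query points do not depend on answers to earlier queries (they may depend on $f$, on $x$ and on the algorithm's randomness). *)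

(* Defs.v *)
From HB Require Import structures.
From mathcomp Require Import all_boot all_order all_algebra all_fingroup.
From mathcomp Require Import all_classical all_reals all_analysis.

Set Implicit Arguments.
Unset Strict Implicit.
Unset Printing Implicit Defensive.

Import Order.TTheory GRing.Theory Num.Theory.
Import numFieldNormedType.Exports.

Local Open Scope classical_set_scope.
Local Open Scope ring_scope.

Notation cube n := 'rV['F_2]_n.
Notation boolfun n := {ffun cube n -> 'F_2}.

Definition isomorphism n (f : boolfun n) (s : 'S_n) : boolfun n :=
  [ffun x : cube n => f (\row_i x 0 (s i))].

Definition eps_close (R : realType) n (eps : R) (f g : boolfun n) : Prop :=
  #|[set x : cube n | f x != g x]%SET|%:R / #|{: cube n}|%:R <= eps.

(* A randomized non-adaptive algorithm with input in Z_2^n and with randomness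
   in T. The query points depend only on the input and on the randomness;
   [decide] receives the answers in the order of the queries, and can recompute
   the query points from its first two arguments. *)
Record nonadaptive_algorithm (n q : nat) (d : measure_display)
    (T : measurableType d) := NonadaptiveAlgorithm {
  query : cube n -> T -> seq (cube n);
  decide : cube n -> T -> seq 'F_2 -> 'F_2;
  size_query : forall x w, (size (query x w) <= q)%N;
  measurable_query : forall x s, measurable [set w | query x w = s];
  measurable_decide : forall x a b, measurable [set w | decide x w a = b]
}.

Definition output n q d (T : measurableType d)
    (A : nonadaptive_algorithm n q T) (g : boolfun n) (x : cube n) (w : T)
    : 'F_2 :=
  decide A x w (map g (query A x w)).

Definition nonadaptively_locally_correctable (R : realType) n (q : nat)
    (eps : R) (f : boolfun n) : Prop :=
  exists (d : measure_display) (T : measurableType d) (P : probability T R)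
         (A : nonadaptive_algorithm n q T),
  forall (s : 'S_n) (g : boolfun n), eps_close eps g (isomorphism f s) ->
  forall x : cube n,
    ((2 / 3)%:E <= P [set w | output A g x w = isomorphism f s x])%E.

Definition boolfun_fraction (R : realType) n (C : boolfun n -> Prop) : R :=
  #|[set f : boolfun n | `[< C f >]]%SET|%:R / #|{: boolfun n}|%:R.

(* Main.v *)
(* Fix a point [x] of weight about n/2. Erasing the value at [x] from an
   isomorphism of f changes at most one value, so a corrector must predict
   [f (s x)] from the erased table of [f_s], for a typical permutation [s].
   Averaging over its randomness gives one query list and one decision rule that
   are right for at least 3/5 of the permutations. For a fixed list and rule, the
   number of right minus the number of wrong permutations is a function of f which
   has mean zero when f is resampled on the orbit of [x]; changing f at one point of
   that orbit, whose size N is at least 2^(n/2), affects a fraction of at most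
   (q+1)/N of the permutations. By McDiarmid's inequality, 3/5 is reached by a
   fraction of at most exp(- N / (200 (q+1)^2)) of the functions, which beats the
   union bound over the 2^(nq) lists and 2^(2^q) rules. *)
Require Import Defs.
From HB Require Import structures.
From mathcomp Require Import all_boot all_order all_algebra all_fingroup.
From mathcomp Require Import all_classical all_reals all_analysis.
From mathcomp Require Import measurable_realfun.
From mathcomp Require Import ring lra zify.

Set Implicit Arguments.
Unset Strict Implicit.
Unset Printing Implicit Defensive.

Import Order.TTheory GRing.Theory Num.Theory.
Import numFieldNormedType.Exports.

Local Open Scope classical_set_scope.
Local Open Scope ring_scope.

(** * Exponential moments under bounded differences *)

Section BoundedDifferences.
Context {R : realType}.

(** Inverting [1 - t <= expR (- t)] bounds the mean by [1 / (1 - d ^+ 2)], which is at most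
    [1 + 2 * d ^+ 2] as soon as [d ^+ 2 <= 1 / 2]. *)
Lemma cosh_le_expR (d : R) : `|d| <= 1 / 2 ->
  (expR d + expR (- d)) / 2 <= expR (2 * d ^+ 2).
Proof.
rewrite ler_norml => /andP[d1 d2].
have expR_le_inv (t : R) : t < 1 -> expR t <= (1 - t)^-1.
  move=> t1; rewrite -[t in expR t]opprK expRN lef_pV2 ?posrE ?expR_gt0 ?subr_gt0 //.
  exact: expR_ge1Dx.
have e1 : expR d <= (1 - d)^-1 by apply: expR_le_inv; lra.
have e2 : expR (- d) <= (1 + d)^-1.
  by have := expR_le_inv (- d); rewrite opprK; apply; lra.
have e3 := expR_ge1Dx (2 * d ^+ 2).
apply: le_trans e3; apply: (@le_trans _ _ (((1 - d)^-1 + (1 + d)^-1) / 2)).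
  by rewrite ler_pM2r ?invr_gt0 // lerD.
have -> : ((1 - d)^-1 + (1 + d)^-1) / 2 = (1 - d ^+ 2)^-1.
  by field; apply/and3P; split; apply/lt0r_neq0; nra.
have : 0 <= d ^+ 2 <= 1 / 4 by apply/andP; split; nra.
move: (d ^+ 2) => u /andP[u0 u1].
by rewrite -div1r ler_pdivrMr; nra.
Qed.

Lemma expR_mean_le (a b : R) : `|a - b| <= 1 ->
  (expR a + expR b) / 2 <= expR ((a - b) ^+ 2 / 2) * expR ((a + b) / 2).
Proof.
move=> ab; have := @cosh_le_expR ((a - b) / 2).
have -> : 2 * ((a - b) / 2) ^+ 2 = (a - b) ^+ 2 / 2 by field.
rewrite normrM [`|2^-1|]ger0_norm // ler_pM2r // => /(_ ab) H.
have -> : (expR a + expR b) / 2 =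
    (expR ((a - b) / 2) + expR (- ((a - b) / 2))) / 2 * expR ((a + b) / 2).
  have -> : (a - b) / 2 = a - (a + b) / 2 by field.
  have -> : - (a - (a + b) / 2) = b - (a + b) / 2 by field.
  rewrite mulrAC; congr (_ / _).
  by rewrite mulrDl -!expRD !subrK.
by rewrite ler_pM2r ?expR_gt0.
Qed.

Context {T : finType}.
Local Notation fT := {ffun T -> 'F_2}.

Definition flip (y : T) (f : fT) : fT :=
  [ffun z => if z == y then f z + 1 else f z].

(** Conditional expectation of [F] given all values of a uniform [f] except the one at [y]. *)
Definition flip_mean (y : T) (F : fT -> R) (f : fT) : R :=
  (F f + F (flip y f)) / 2.

Definition flip_means (l : seq T) (F : fT -> R) : fT -> R :=
  foldr flip_mean F l.

Lemma F2_addrr (a : 'F_2) : a + a = 0.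
Proof. by case: a => [[|[|]]] //= ?; apply/val_inj. Qed.

Lemma F2_eqD1 (a b : 'F_2) : (a == b + 1) = (a != b).
Proof. by case: a b => [[|[|]]] //= ? [[|[|]]]. Qed.

Lemma flipK y : involutive (flip y).
Proof.
move=> f; apply/ffunP => z; rewrite !ffunE; case: eqP => // _.
by rewrite -addrA F2_addrr addr0.
Qed.

Lemma flipC y z f : flip y (flip z f) = flip z (flip y f).
Proof. by apply/ffunP => t; rewrite !ffunE; do 2 case: eqP. Qed.

Lemma flip_meanC y z F : flip_mean y (flip_mean z F) = flip_mean z (flip_mean y F).
Proof. by apply/funext => f; rewrite /flip_mean (flipC z y); ring. Qed.

(** The averagings commute, so the one at [y] can be applied to [F] first; the others preserve the
    zero function. *)
Lemma flip_means_eq0 l y F :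
  y \in l -> flip_mean y F = (fun=> 0) -> flip_means l F = (fun=> 0).
Proof.
have mean0 z : flip_mean z (fun=> 0) = (fun=> 0).
  by apply/funext => f; rewrite /flip_mean addr0 mul0r.
have means0 s : flip_means s (fun=> 0) = (fun=> 0).
  by elim: s => //= z s ->.
have meansC s : flip_mean y (flip_means s F) = flip_means s (flip_mean y F).
  by elim: s => //= z s <-; rewrite flip_meanC.
move=> + F0; elim: l => //= z l IH; rewrite inE => /predU1P[<-|/IH ->//].
by rewrite meansC F0.
Qed.

Lemma flip_means_sum (I : finType) l (F : I -> fT -> R) :
  flip_means l (fun f => \sum_i F i f) = (fun f => \sum_i flip_means l (F i) f).
Proof.
elim: l => //= y l ->; apply/funext => f.
by rewrite /flip_mean -big_split /= big_distrl.
Qed.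

(** Flips commute, so each averaging replaces the difference by the mean of two differences already
    bounded by [c]. *)
Lemma flip_means_diff l y F c :
  (forall f, `|F f - F (flip y f)| <= c) ->
  forall f, `|flip_means l F f - flip_means l F (flip y f)| <= c.
Proof.
move=> Fc; elim: l => //= z l IH f; rewrite /flip_mean flipC.
set G := flip_means l F in IH *.
have := IH f; have := IH (flip z f).
by rewrite !ler_norml => /andP[? ?] /andP[? ?]; apply/andP; split; lra.
Qed.

Lemma sum_expR_flip_mean y F c : c <= 1 ->
  (forall f, `|F f - F (flip y f)| <= c) ->
  \sum_f expR (F f) <= expR (c ^+ 2 / 2) * \sum_f expR (flip_mean y F f).
Proof.
move=> c1 Fc.
(* The involution [flip y] pairs up the terms, and [expR_mean_le] then applies to each pair. *)
have -> : \sum_f expR (F f) = \sum_f (expR (F f) + expR (F (flip y f))) / 2.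
  rewrite -big_distrl big_split /=.
  rewrite [X in (_ + X) / _](_ : _ = \sum_f expR (F f)); first by field.
  by rewrite [RHS](reindex_inj (inv_inj (flipK y))).
rewrite big_distrr /=; apply: ler_sum => f _.

apply: le_trans (expR_mean_le _) _; first exact: le_trans (Fc f) c1.
rewrite ler_pM2r ?expR_gt0 // ler_expR ler_pM2r // -real_normK ?num_real //.
by rewrite lerXn2r ?nnegrE // (le_trans _ (Fc f)).
Qed.

(* McDiarmid's inequality in exponential form: each averaging over one bit
   costs a factor [expR (c ^+ 2 / 2)]. *)
Lemma sum_expR_bounded_diff l F c : c <= 1 ->
  (forall y f, y \in l -> `|F f - F (flip y f)| <= c) ->
  flip_means l F = (fun=> 0) ->
  \sum_f expR (F f) <= expR (c ^+ 2 / 2 *+ size l) * #|{: fT}|%:R.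
Proof.
move=> c1 Fc F0.
suff : \sum_f expR (F f) <=
    expR (c ^+ 2 / 2 *+ size l) * \sum_f expR (flip_means l F f).
  by rewrite F0 expR0 sumr_const.
elim: l Fc {F0} => [|y l IH] Fc /=; first by rewrite mulr0n expR0 mul1r.
apply: le_trans (IH _) _; first by move=> z f zl; apply: Fc; rewrite inE zl orbT.
rewrite [_ *+ (size l).+1]mulrSr expRD -mulrA ler_pM2l ?expR_gt0 //.
apply: sum_expR_flip_mean => //; apply: flip_means_diff => f.
by apply: Fc; rewrite inE eqxx.
Qed.

End BoundedDifferences.

(** * Orbits of points under coordinate permutations *)

Lemma isomorphismE n (f : boolfun n) (s : 'S_n) x :
  isomorphism f s x = f (col_perm s x).
Proof. by rewrite ffunE; congr (f _); apply/rowP => i; rewrite !mxE. Qed.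

Definition perm_orbit n (x : cube n) : {set cube n} :=
  [set col_perm s x | s : 'S_n]%SET.

(** Left multiplication injects the permutations sending [z] to [y] into those sending [z] to any
    other point of the orbit, and these fibres are disjoint. *)
Lemma card_perm_to n (x y z : cube n) : y \in perm_orbit x ->
  (#|[set s : 'S_n | col_perm s z == y]%SET| * #|perm_orbit x| <= n`!)%N.
Proof.
move=> yO; pose F t := [set s : 'S_n | col_perm s z == t]%SET.
have F_le t : t \in perm_orbit x -> (#|F y| <= #|F t|)%N.
  case/imsetP: yO => a _ ya /imsetP[b _ tb].
  rewrite -(card_imset (mem (F y)) (mulgI (b * a^-1)%g)); apply/subset_leq_card.
  apply/fintype.subsetP => _ /imsetP[s + ->]; rewrite !inE => /eqP sy.
  by rewrite col_permM sy ya -col_permM mulgVK -tb.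
rewrite -card_Sn mulnC -sum_nat_const.
apply: (@leq_trans (\sum_(t in perm_orbit x) #|F t|)); first exact: leq_sum.
rewrite (eq_bigr (fun t => \sum_(s : 'S_n | col_perm s z == t) 1)%N); last first.
  by move=> t _; rewrite sum1dep_card.
rewrite (exchange_big_dep predT) //= -sum1_card; apply: leq_sum => s _.
rewrite sum1dep_card.
  apply: (@leq_trans #|[set col_perm s z]%SET|); last by rewrite cards1.
  apply: subset_leq_card; apply/fintype.subsetP => t.
  by rewrite !inE => /andP[_ /eqP ->].
Qed.

Definition half_point n : cube n := \row_i (i < n./2)%N%:R.

(** With [m = n./2], swapping [j] and [m + j] for all [j] in [A] puts zeros exactly at the places of
    [A] among the first [m], so distinct sets [A] give distinct orbit points. *)
Lemma card_perm_orbit_half n : (2 ^ n./2 <= #|perm_orbit (half_point n)|)%N.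
Proof.
have m2n : (n./2 + n./2 <= n)%N.
  by rewrite addnn -[leqRHS]odd_double_half leq_addl.
set m := n./2 in m2n *.
have lt1 (j : 'I_m) : (j < n)%N.
  by rewrite (leq_trans (ltn_ord j)) ?(leq_trans _ m2n) ?leq_addr.
have lt2 (j : 'I_m) : (m + j < n)%N by rewrite (leq_trans _ m2n) // ltn_add2l.
pose lo j := Ordinal (lt1 j); pose hi j := Ordinal (lt2 j).
pose sw (A : {set 'I_m}) : 'S_n := (\prod_(j <- enum A) tperm (lo j) (hi j))%g.
have swP (A : {set 'I_m}) j : sw A (lo j) = if j \in A then hi j else lo j.
  have lohi i k : (lo i == hi k) = false.
    by apply/negbTE; rewrite -val_eqE /= neq_ltn (leq_trans (ltn_ord i)) ?leq_addr.
  have lolo i k : (lo i == lo k) = (i == k) by [].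
  have hihi i k : (hi i == hi k) = (i == k) by rewrite -!val_eqE /= eqn_add2l.
  rewrite /sw -(mem_enum A); move: (enum_uniq A).
  have fix_hi l k : k \notin l -> (\prod_(i <- l) tperm (lo i) (hi i))%g (hi k) = hi k.
    elim: l => [|i l IH]; first by rewrite big_nil perm1.
    rewrite inE negb_or => /andP[ki kl]; rewrite big_cons permM tpermD ?IH //.
      by rewrite lohi.
    by rewrite hihi eq_sym.
  elim: (enum A) => [|i l IH] /=; first by rewrite big_nil perm1.
  move=> /andP[il /IH{}IH]; rewrite big_cons permM inE.
  case: eqVneq => [->|ji] /=; first by rewrite tpermL fix_hi.
  by rewrite tpermD ?IH // ?lolo 1?eq_sym // lohi.
rewrite -[m in (2 ^ m)%N]card_ord -cardsT -card_powerset.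
pose v A := col_perm (sw A) (half_point n).
have vinj : injective v.
  move=> A B AB; apply/setP => j; move/rowP/(_ (lo j)): AB.
  rewrite !mxE !swP -/m.
  have h1 : (hi j < m)%N = false by rewrite /= ltnNge leq_addr.
  have h2 : (lo j < m)%N := ltn_ord j.
  by case: (j \in A) (j \in B) => [] [] //; rewrite h1 h2 => /eqP.
rewrite -(card_imset _ vinj); apply/subset_leq_card/fintype.subsetP => _ /imsetP[A _ ->].
exact: imset_f.
Qed.

(** * Derandomizing a corrector on erased tables *)

Definition erased n (x : cube n) (f : boolfun n) : boolfun n :=
  [ffun y => if y == x then 0 else f y].

Lemma erasedE n (x : cube n) f y : erased x f y = if y == x then 0 else f y.
Proof. exact: ffunE. Qed.

Lemma card_cube n : #|{: cube n}| = (2 ^ n)%N.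
Proof. by rewrite card_mx card_Fp // mul1n. Qed.

Lemma erased_close (R : realType) n (x : cube n) (f : boolfun n) :
  eps_close (2 ^- n : R) (erased x f) f.
Proof.
rewrite /eps_close card_cube natrX ler_pdivrMr ?exprn_gt0 //.
rewrite mulVf ?expf_neq0 ?pnatr_eq0 // (ler_nat _ _ 1).
apply: (@leq_trans #|[set x]%SET|); last by rewrite cards1.
apply: subset_leq_card; apply/fintype.subsetP => y.
by rewrite !inE ffunE; case: (eqVneq y x) => // _; rewrite eqxx.
Qed.

Section Agreement.
Context {n : nat} (x : cube n) (f : boolfun n).

Definition agreeing (qs : seq (cube n)) (h : seq 'F_2 -> 'F_2) : {set 'S_n} :=
  [set s | h (map (erased x (isomorphism f s)) qs) == isomorphism f s x]%SET.

(** The countably many query lists partition the randomness, and on each piece the answers are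
    fixed. *)
Lemma measurable_output q d (T : measurableType d)
    (A : nonadaptive_algorithm n q T) (g : boolfun n) b :
  measurable [set w | output A g x w = b].
Proof.
have -> : [set w | output A g x w = b] =
    \bigcup_(s in [set: seq (cube n)])
      ([set w | query A x w = s] `&` [set w | decide A x w (map g s) = b]).
  apply/seteqP; split => w /=; first by exists (query A x w).
  by rewrite /output => -[s _ [/= -> ]].
apply: countable_bigcupT_measurable => [|s]; first exact: countableP.
apply: measurableI.
- exact: measurable_query.
- exact: measurable_decide.
Qed.

Lemma exists_agreeing (R : realType) q :
  nonadaptively_locally_correctable q (2 ^- n : R) f ->
  exists (qs : seq (cube n)) (h : seq 'F_2 -> 'F_2),
    (size qs <= q)%N /\ (n`!%:R * (3 / 5) <= #|agreeing qs h|%:R :> R).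
Proof.
case=> d [T [P [A AP]]].
pose E s := [set w | output A (erased x (isomorphism f s)) x w = isomorphism f s x].
have mE s : measurable (E s) by exact: measurable_output.
suff [w Pw] : exists w, n`!%:R * (3 / 5) <= #|[set s | `[< E s w >]]%SET|%:R :> R.
  exists (query A x w), (decide A x w); split; first exact: size_query.
  apply: le_trans Pw _; rewrite ler_nat; apply: subset_leq_card.
  by apply/fintype.subsetP => s; rewrite /agreeing !inE => /eqP.
(* Otherwise the expected number of rightly predicted permutations is at most [3 / 5] of [n!], while
   correctability makes it at least [2 / 3] of [n!]. *)
apply: contrapT => /forallNP Hw.
have lb : ((n`!%:R * (2 / 3))%:E <= \sum_(s : 'S_n) P (E s))%E.
  have -> : n`!%:R * (2 / 3) = \sum_(s : 'S_n) (2 / 3) :> R.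
    by rewrite sumr_const -card_Sn mulr_natl.
  rewrite -sumEFin; apply: lee_sum => s _.
  exact: AP (erased_close _ _ _) _.
have ub : (\sum_(s : 'S_n) P (E s) <= (n`!%:R * (3 / 5))%:E)%E.
  have -> : (\sum_(s : 'S_n) P (E s) =
      \int[P]_w (\sum_(s : 'S_n) (\1_(E s) w)%:E))%E.
    rewrite ge0_integral_sum //.
    - by apply: eq_bigr => s _; rewrite integral_indic // setIT.
    - by move=> s; apply/measurable_EFinP; exact: measurable_indic.
  have <- : (\int[P]_w (cst (n`!%:R * (3 / 5))%:E w) = (n`!%:R * (3 / 5))%:E)%E.
    by rewrite integral_cst // [X in (_ * X)%E](probability_setT P) mule1.
  apply: ge0_le_integral => //.
  - by move=> w _; apply: sume_ge0 => s _; rewrite lee_fin.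
  - by apply: emeasurable_sum => s; apply/measurable_EFinP; exact: measurable_indic.
  move=> w _ /=; rewrite sumEFin lee_fin; have /negP := Hw w.
  rewrite -ltNge => /ltW; apply: le_trans.
  rewrite -sum1_card natr_sum [leRHS]big_mkcond /=; apply: ler_sum => s _.
  by rewrite inE indicE (_ : (w \in E s) = `[< E s w >]) //; case: ifP.
have := le_trans lb ub; rewrite lee_fin ler_pM2l ?ltr0n ?fact_gt0 //.
by apply/negP; rewrite -ltNge; lra.
Qed.

End Agreement.

(** * Concentration of the number of right predictions *)

Section Deviation.
Context {R : realType} {n : nat} (x : cube n).
Variables (qs : seq (cube n)) (h : seq 'F_2 -> 'F_2).

Definition vote (s : 'S_n) (f : boolfun n) : R :=
  if s \in agreeing x f qs h then 1 else -1.

Lemma sum_vote f : \sum_s vote s f = #|agreeing x f qs h|%:R *+ 2 - n`!%:R.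
Proof.
have vE s : vote s f = (s \in agreeing x f qs h)%:R *+ 2 - 1.
  by rewrite /vote; case: ifP => _; rewrite ?mul0rn ?sub0r // mulr2n addrK.
rewrite (eq_bigr _ (fun s _ => vE s)) big_split /= sumrN sumr_const card_Sn.
rewrite sumrMnl -sum1_card natr_sum [in RHS]big_mkcond /=.
by congr (_ *+ _ - _); apply: eq_bigr => s _; case: ifP.
Qed.

(** The flip leaves the erased table, hence the prediction, unchanged but reverses the correct
    answer: exactly one of the two votes is right. *)
Lemma flip_mean_vote s : flip_mean (col_perm s x) (vote s) = (fun=> 0).
Proof.
apply/funext => f; rewrite /flip_mean /vote /agreeing !inE.
have -> : erased x (isomorphism (flip (col_perm s x) f) s) =
    erased x (isomorphism f s).
  apply/ffunP => z; rewrite !erasedE !isomorphismE ffunE.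
  case: (eqVneq z x) => // zx; case: eqP => // /(congr1 (col_perm s^-1)).
  by rewrite -!col_permM mulVg !col_perm1 => /eqP; rewrite (negbTE zx).
rewrite !isomorphismE ffunE eqxx F2_eqD1.
by case: eqP; rewrite ?subrr ?addNr mul0r.
Qed.

(** A vote sees [f] only at the images under [s] of the queries and of [x], the latter through the
    correct answer. *)
Lemma vote_diff s y f : `|vote s f - vote s (flip y f)| <=
  2 * \sum_(z <- x :: qs) (col_perm s z == y)%:R.
Proof.
have [/hasP[z zq /eqP zy]|/hasPn noy] := boolP (has (fun z => col_perm s z == y) (x :: qs)).
  apply: (@le_trans _ _ 2).
    by rewrite /vote; do 2 case: ifP => _; rewrite ler_norml; apply/andP; split; lra.
  rewrite ler_peMr // (big_rem z) //= zy eqxx lerDl.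
  by apply: sumr_ge0 => *; rewrite ler0n.
have eqf z : z \in x :: qs -> isomorphism (flip y f) s z = isomorphism f s z.
  by move=> /noy zy; rewrite !isomorphismE ffunE (negbTE zy).
rewrite [vote s (flip y f)](_ : _ = vote s f).
  rewrite subrr normr0 mulr_ge0 // sumr_ge0 // => *.
rewrite /vote /agreeing !inE eqf ?mem_head //.
rewrite (_ : map _ qs = map (erased x (isomorphism f s)) qs) //.
by apply/eq_in_map => z zq; rewrite !erasedE eqf // inE zq orbT.
Qed.

(** After exchanging sums, [card_perm_to] bounds the permutations that take each of the
    [(size qs).+1] points to [y]. *)
Lemma sum_vote_diff y f : y \in perm_orbit x ->
  `|\sum_s vote s f - \sum_s vote s (flip y f)| <=
  2 * (size qs).+1%:R * n`!%:R / #|perm_orbit x|%:R.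
Proof.
move=> yO; rewrite -sumrB; apply: le_trans (ler_norm_sum _ _ _) _.
apply: le_trans (ler_sum _ (fun s _ => vote_diff s y f)) _.
have O0 : 0 < #|perm_orbit x|%:R :> R.
  by rewrite ltr0n; apply/card_gt0P; exists y.
rewrite -mulr_sumr exchange_big /= -!mulrA ler_pM2l //.
apply: (@le_trans _ _ (\sum_(z <- x :: qs) n`!%:R / #|perm_orbit x|%:R)).
  apply: ler_sum => z _; rewrite ler_pdivlMr //.
  apply: (@le_trans _ _ (#|[set s : 'S_n | col_perm s z == y]%SET| * #|perm_orbit x|)%:R).
    rewrite natrM ler_pM2r // -sum1_card natr_sum [leRHS]big_mkcond /=.
    by apply: ler_sum => s _; rewrite inE; case: ifP.
  by rewrite ler_nat card_perm_to.
by rewrite big_const_seq count_predT iter_addr_0 -[leLHS]mulr_natl.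
Qed.

Lemma card_predictable q : (size qs <= q)%N ->
  #|[set f : boolfun n | n`!%:R * (3 / 5) <= #|agreeing x f qs h|%:R :> R]%SET|%:R
  <= expR (- (#|perm_orbit x|%:R / (200 * q.+1%:R ^+ 2))) * #|{: boolfun n}|%:R :> R.
Proof.
move=> sq.
have N0 : 0 < #|perm_orbit x|%:R :> R.
  by rewrite ltr0n; apply/card_gt0P; exists (col_perm 1 x); exact: imset_f.
have q0 : 0 < q.+1%:R :> R by rewrite ltr0n.
have n0 : 0 < n`!%:R :> R by rewrite ltr0n fact_gt0.
have q1 : 1 <= q.+1%:R :> R by rewrite ler1n.
have sq' : (size qs).+1%:R <= q.+1%:R :> R by rewrite ler_nat.
set N : R := #|perm_orbit x|%:R in N0 *.
set Q : R := q.+1%:R in q0 q1 sq' *.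
set fact : R := n`!%:R in n0 *.
(* [l * sum_vote / n!] has bounded differences [c]; [l] minimises the
   resulting exponent [c ^+ 2 * N / 2 - l / 5]. *)
pose l := N / (20 * Q ^+ 2); pose c := (10 * Q)^-1.
have l0 : 0 < l by rewrite divr_gt0 // mulr_gt0 // exprn_gt0.
have lf0 : 0 < l / fact by exact: divr_gt0.
have c1 : c <= 1 by rewrite invf_le1 ?mulr_gt0 //; nra.
pose F f := \sum_s l / fact * vote s f.
have FE f : F f = l / fact * \sum_s vote s f by rewrite mulr_sumr.
have := @sum_expR_bounded_diff _ _ (enum (perm_orbit x)) F c c1.
have H1 y f : y \in enum (perm_orbit x) -> `|F f - F (flip y f)| <= c.
  rewrite mem_enum => /(sum_vote_diff f) H; rewrite !FE -mulrBr normrM.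
  rewrite (ger0_norm (ltW lf0)).
  rewrite -ler_pdivlMl //; apply: le_trans H _.
  have -> : (l / fact)^-1 * c = 2 * Q * fact / N.
    by rewrite /l /c; field; rewrite !gt_eqF.
  by rewrite !ler_pM2r ?invr_gt0 // ler_pM2l.
(* By linearity each vote may be killed at its own orbit point [col_perm s x]. *)
have H2 : flip_means (enum (perm_orbit x)) F = (fun=> 0).
  rewrite flip_means_sum; apply/funext => f; apply: big1 => s _.
  rewrite (@flip_means_eq0 _ _ _ (col_perm s x)) ?mem_enum //; first by apply: imset_f.
  apply/funext => g; have := congr1 (fun G => G g) (flip_mean_vote s).
  by rewrite /flip_mean -mulrDr -mulrA => ->; rewrite mulr0.
move=> /(_ H1 H2); rewrite -cardE -mulr_natr -/N => H.
(* Agreement on [3 / 5] makes the votes sum to at least [6 / 5 - 1 = 1 / 5] of [n!], so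
   [F f >= l / 5]. *)
have Markov : expR (l / 5) *
    #|[set f : boolfun n | fact * (3 / 5) <= #|agreeing x f qs h|%:R :> R]%SET|%:R
    <= \sum_f expR (F f).
  rewrite -sum1_card natr_sum mulr_sumr [leLHS]big_mkcond; apply: ler_sum => f _.
  case: ifP => [|_]; last exact: expR_ge0.
  rewrite inE mulr1 ler_expR FE sum_vote -/fact => fP.
  rewrite -mulrA ler_pM2l // -ler_pdivrMl ?invr_gt0 // invrK mulr2n.
  lra.
rewrite -(ler_pM2l (expR_gt0 (l / 5))); apply: le_trans Markov _.
apply: le_trans H _; rewrite mulrA -expRD ler_pM2r; last first.
  by rewrite ltr0n; apply/card_gt0P; exists 0.
(* Both exponents equal [l / 10]. *)
rewrite ler_expR le_eqVlt; apply/orP; left; apply/eqP.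
by rewrite /l /c; field; rewrite gt_eqF.
Qed.

End Deviation.

(** * Finite encoding of the algorithms, union bound and limit *)

Definition tuple_decision m (h : {ffun m.-tuple 'F_2 -> 'F_2}) (l : seq 'F_2) : 'F_2 :=
  h [tuple l`_i | i < m].

(** Padding the list with [x] fixes its length, and the new rule ignores the extra answers; lists
    and rules then range over finite types. *)
Lemma agreeing_tuple n (x : cube n) (f : boolfun n) m qs h : (size qs <= m)%N ->
  exists (qs' : m.-tuple (cube n)) (h' : {ffun m.-tuple 'F_2 -> 'F_2}),
    agreeing x f qs' (tuple_decision h') = agreeing x f qs h.
Proof.
move=> qm; have sz : size (qs ++ nseq (m - size qs) x) == m.
  by rewrite size_cat size_nseq subnKC.
exists (Tuple sz), [ffun t : m.-tuple 'F_2 => h (take (size qs) t)].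
apply/setP => s; rewrite /agreeing !inE /tuple_decision ffunE /=.
set e := erased x _.
have -> : [tuple (map e (qs ++ nseq (m - size qs) x))`_i | i < m] =
    map e (qs ++ nseq (m - size qs) x) :> seq _.
  apply: (@eq_from_nth _ 0); first by rewrite size_tuple size_map (eqP sz).
  move=> i; rewrite size_tuple => im.
  by rewrite -[i]/(val (Ordinal im)) -tnth_nth tnth_mktuple.
by rewrite map_cat take_size_cat ?size_map.
Qed.

Lemma union_bound (R : realType) n (C : boolfun n -> Prop) (I : finType)
    (B : I -> {set boolfun n}) (b : R) :
  (forall f, C f -> exists i, f \in B i) ->
  (forall i, #|B i|%:R <= b * #|{: boolfun n}|%:R) ->
  boolfun_fraction R C <= #|I|%:R * b.
Proof.
move=> CB Bb; rewrite /boolfun_fraction ler_pdivrMr; last first.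
  by rewrite ltr0n; apply/card_gt0P; exists 0.
apply: (@le_trans _ _ (\sum_(i : I) #|B i|%:R)); last first.
  by rewrite -mulrA mulr_natl -sumr_const; apply: ler_sum => i _; exact: Bb.
rewrite -natr_sum ler_nat.
rewrite (eq_bigr (fun i => \sum_f (f \in B i))%N); last first.
  by move=> i _; rewrite -sum1_card big_mkcond.
rewrite exchange_big -sum1_card big_mkcond; apply: leq_sum => f _.
rewrite inE; case: asboolP => // /CB[i fi].
by rewrite (bigD1 i) //= fi.
Qed.

(** With [M = 2 ^ m], the left side is at most [200 * M ^ 2 * (101 * M ^ 2) <= M ^ 19], while
    [50 * m <= n./2] gives [M ^ 50] on the right. The summand [n] is kept for the final decay. *)
Lemma half_exponent_bound n m : (0 < m)%N -> (m = n %/ 100)%N ->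
  (200 * m.+1 ^ 2 * (n * m + 2 ^ m + n) <= 2 ^ n./2)%N.
Proof.
move=> m0 mn; set M := (2 ^ m)%N.
have mM : (m.+1 <= M)%N by exact: ltn_expl.
have nM : (n <= 100 * M)%N.
  apply: (@leq_trans (100 * m.+1)%N); last by rewrite leq_mul2l.
  by rewrite mn; lia.
have M2 : (2 <= M)%N by rewrite (leq_trans _ mM).
apply: (@leq_trans (M ^ 50)%N); last first.
  by rewrite -expnM leq_exp2l //; lia.
apply: (@leq_trans (200 * M ^ 2 * (101 * M ^ 2))%N).
  rewrite leq_mul // ?leq_mul2l ?leq_exp2r //.
  have : (n * m.+1 <= 100 * M * M)%N by exact: leq_mul.
  nia.
have h8 : (200 <= M ^ 8)%N by rewrite (@leq_trans (2 ^ 8)) // leq_exp2r.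
have h7 : (101 <= M ^ 7)%N by rewrite (@leq_trans (2 ^ 7)) // leq_exp2r.
apply: (@leq_trans (M ^ 8 * M ^ 2 * (M ^ 7 * M ^ 2))%N).
  by rewrite !leq_mul.
by rewrite -!expnD leq_exp2l.
Qed.

Theorem theorem1p4 (R : realType) :
  (fun n : nat =>
     boolfun_fraction R (fun f : boolfun n =>
       exists q : nat, q%:R < n%:R / 100 :> R /\
         nonadaptively_locally_correctable q (2 ^- n : R) f))
    @ \oo --> (0 : R).
Proof.
(* The fraction will be at most [expR (- n%:R)], hence at most [1 / (n + 1)]. *)
apply: (@squeeze_cvgr _ _ _ _ (fun=> 0) harmonic); [|exact: cvg_cst|exact: cvg_harmonic].
near=> n; apply/andP; split; first by rewrite divr_ge0.
have n100 : (100 <= n)%N by near: n; exists 100%N.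
pose m := (n %/ 100)%N; pose x := half_point n.
pose I : finType := (m.-tuple (cube n) * {ffun m.-tuple 'F_2 -> 'F_2})%type.
pose b : R := expR (- (#|perm_orbit x|%:R / (200 * m.+1%:R ^+ 2))).
pose B (i : I) := [set f : boolfun n |
  n`!%:R * (3 / 5) <= #|agreeing x f i.1 (tuple_decision i.2)|%:R :> R]%SET.
apply: (@le_trans _ _ (#|I|%:R * b)).
  apply: (union_bound (B := B)) => [f [q [qn fq]]|i]; last first.
    by apply: card_predictable; rewrite size_tuple.
  have [qs [h [sq agr]]] := exists_agreeing x fq.
  (* Every admissible [q] is at most [m], so one union bound over lists of length [m] covers all of
     them. *)
  have qm : (q <= m)%N.
    move: qn; rewrite ltr_pdivlMr // -natrM ltr_nat /m; lia.
  have [qs' [h' E]] := agreeing_tuple x f h (leq_trans sq qm).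
  by exists (qs', h'); rewrite inE E.
have cardI : #|{: I}| = (2 ^ (n * m + 2 ^ m))%N.
  by rewrite card_prod card_ffun !card_tuple card_cube card_Fp // -expnM expnD.
have e2 k : (2 ^ k)%:R <= expR k%:R :> R.
  elim: k => [|k IH]; first by rewrite expR0.
  rewrite expnSr natrM -[k.+1%:R]natr1 expRD ler_pM //.
  by have := @expR_ge1Dx R 1; lra.
rewrite cardI; apply: le_trans (ler_wpM2r (expR_ge0 _) (e2 _)) _.
rewrite -expRD /harmonic.
apply: (@le_trans _ _ (expR (- n%:R))); last first.
  rewrite expRN lef_pV2 ?posrE ?expR_gt0 //.
  by rewrite -natr1 addrC expR_ge1Dx.
rewrite ler_expR.
have : (n * m + 2 ^ m + n)%:R <= #|perm_orbit x|%:R / (200 * m.+1%:R ^+ 2) :> R.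
  rewrite ler_pdivlMr ?mulr_gt0 ?exprn_gt0 ?ltr0n //.
  rewrite -natrX -!natrM ler_nat mulnC.
  apply: leq_trans (card_perm_orbit_half n); apply: half_exponent_bound => //.
  by rewrite divn_gt0.
by move=> H; rewrite lerBlDr [leRHS]addrC lerBrDr -natrD.
Unshelve. all: by end_near.
Qed.
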